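(* Let $a(x), b(x)$ be smooth real functions with $b>0$, with diagonal nodal matrices $\mathbf a,\mathbf b\in\mathbb{R}^{(2P+2)\times(2P+2)}$. Let $\mathbf U(t),\mathbf W(t)\in\mathbb{R}^{2P+2}$ be a solution of the semi-discrete two-element interface scheme $$\frac{d}{dt}\mathbf U=\mathbf a\widetilde{\mathbf D}\mathbf U+\mathbf W,\qquad \frac{d}{dt}\mathbf W=\widetilde{\mathbf D}(\mathbf a\mathbf W)-\mathbf H^{-1}\mathbf A_b\mathbf U,$$ for which the external boundary contribution vanishes, i.e. $\mathbf 1^T\widetilde{\mathbf B}\,\mathbf a\mathbf W=0$ for all $t$, where $\mathbf 1=(1,\dots,1)^T\in\mathbb{R}^{2P+2}$. Then the scheme is conservative: $$\frac{d}{dt}\langle \mathbf 1,\mathbf W\rangle_{\mathbf H}=\frac{d}{dt}\Big\langle \mathbf 1,\ \frac{d}{dt}\mathbf U-\mathbf a\widetilde{\mathbf D}\mathbf U\Big\rangle_{\mathbf H}=0 .$$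
   Context: Element operators: let $P\ge 1$, let $-1=\xi_1<\dots<\xi_{P+1}=1$ be the Gauss-Legendre-Lobatto nodes on $[-1,1]$ with positive weights $\omega_j$ (quadrature exact for polynomials of degree $\le 2P-1$), and let $\phi_i$ be the Lagrange polynomials of degree $P$ with $\phi_i(\xi_j)=\delta_{ij}$. Set $Q_{ij}=\sum_m\omega_m\phi_i(\xi_m)\phi_j'(\xi_m)$; for an element of length $\Delta x>0$ set $H_x=\frac{\Delta x}{2}\mathrm{diag}(\omega_1,\dots,\omega_{P+1})$, $D_x=H_x^{-1}Q$. Two-element operators: the domain is $[B_-,B_+]=\Omega_-\cup\Omega_+$, two elements of length $\Delta x$ meeting at $x_I$; grid vectors in $\mathbb{R}^{2P+2}$ list first the $P+1$ nodal values on $\Omega_-$, then those on $\Omega_+$ (the node $x_I$ is doubled). With $e_l=(1,0,\dots,0)^T$, $e_r=(0,\dots,0,1)^T\in\mathbb{R}^{P+1}$, $$\mathbf H=\begin{pmatrix}H_x&0\\0&H_x\end{pmatrix},\quad \mathbf D=\begin{pmatrix}D_x&0\\0&D_x\end{pmatrix},\quad \widehat{\mathbf B}=\begin{pmatrix}e_re_r^T&-e_re_l^T\\ e_le_r^T&-e_le_l^T\end{pmatrix},\quad \widetilde{\mathbf B}=\begin{pmatrix}-e_le_l^T&0\\0&e_re_r^T\end{pmatrix},$$ $\widetilde{\mathbf D}=\mathbf D-\frac12\mathbf H^{-1}\widehat{\mathbf B}$, $\langle\mathbf U,\mathbf V\rangle_{\mathbf H}=\mathbf V^T\mathbf H\mathbf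 U$. $\mathbf a$, $\mathbf b$ are the diagonal matrices of nodal values of $a$, $b$, and $$\mathbf A_b=\mathbf D^T\mathbf b\mathbf H\mathbf D-\tfrac12\big(\widehat{\mathbf B}^T\mathbf b\mathbf D+\mathbf D^T\mathbf b\widehat{\mathbf B}\big)+\tfrac14\widehat{\mathbf B}^T\mathbf b\mathbf H^{-1}\widehat{\mathbf B}.$$ The scheme discretises the shifted wave equation $\partial_t(u_t-au_x)-\partial_x(a(u_t-au_x)+bu_x)=0$; contributions from the external boundaries $B_\pm$ are ignored. *)

(* Defs.v *)
From HB Require Import structures.
From mathcomp Require Import all_boot all_order all_algebra.
From mathcomp Require Import all_classical all_reals all_analysis.
Set Implicit Arguments.
Unset Strict Implicit.
Unset Printing Implicit Defensive.
Import Order.TTheory GRing.Theory Num.Theory.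
Import numFieldNormedType.Exports.
Local Open Scope classical_set_scope.
Local Open Scope ring_scope.

(* Indices are 0-based: xi ord0 and xi ord_max are the two endpoint nodes. *)
Section Quadrature.
Context {R : realType} {P : nat}.
Implicit Types xi omega : 'I_P.+1 -> R.

(* Rodrigues' formula. *)
Definition legendre (n : nat) : {poly R} :=
  (2 ^+ n * n`!%:R)^-1 *: derivn n (('X^2 - 1) ^+ n).

(* The P.+1 nodes are the roots of (1 - x^2) L_P'(x); as the degree is at most
   P.+1 and the nodes are increasing, these are all the roots. *)
Definition gll_nodes xi : Prop :=
  [/\ xi ord0 = -1,
      xi ord_max = 1,
      forall i j : 'I_P.+1, (i < j)%N -> xi i < xi j &
      forall i, root ((1 - 'X^2) * deriv (legendre P)) (xi i)].

(* size p <= 2 * P says that p has degree at most 2 * P - 1 (when P >= 1). *)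
Definition gll_rule xi omega : Prop :=
  [/\ gll_nodes xi,
      forall j, 0 < omega j &
      forall p : {poly R}, (size p <= 2 * P)%N ->
        \int[lebesgue_measure]_(x in `[-1, 1]) p.[x]
        = \sum_(j < P.+1) omega j * p.[xi j]].

(* The library's lagrange basis takes its sampling points as a sequence that is
   injective on the whole of nat, hence the direct definition. *)
Definition lagrange_poly xi (i : 'I_P.+1) : {poly R} :=
  \prod_(j < P.+1 | j != i) ((xi i - xi j)^-1 *: ('X - (xi j)%:P)).

Lemma lagrange_poly_node xi (i j : 'I_P.+1) : injective xi ->
  (lagrange_poly xi i).[xi j] = (i == j)%:R.
Proof.
move=> xi_inj; rewrite /lagrange_poly horner_prod.
have [<-|ij] := eqVneq i j.
  rewrite big1 // => k ki; rewrite hornerZ hornerXsubC mulVf //.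
  by rewrite subr_eq0 inj_eq // eq_sym.
rewrite (bigD1 j) 1?eq_sym //=.
by rewrite hornerZ hornerXsubC subrr mulr0 mul0r.
Qed.

Lemma size_lagrange_poly xi (i : 'I_P.+1) : injective xi ->
  size (lagrange_poly xi i) = P.+1.
Proof.
move=> xi_inj; rewrite /lagrange_poly scaler_prod size_scale; last first.
  apply/prodf_neq0 => k ki.
  by rewrite invr_eq0 subr_eq0 inj_eq // eq_sym.
rewrite size_prod => [|k _]; last by rewrite polyXsubC_eq0.
rewrite (eq_bigr (fun=> 2)) => [|k _]; last by rewrite size_XsubC.
rewrite sum_nat_const cardC1 card_ord /=.
by rewrite muln2 -addnn -addSn addnK.
Qed.

End Quadrature.

Section Element.
Context {R : realType} {P : nat}.
Variables (xi omega : 'I_P.+1 -> R) (dx : R).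

Definition Q_elt : 'M[R]_P.+1 :=
  \matrix_(i, j) \sum_(m < P.+1) omega m * (lagrange_poly xi i).[xi m]
                                 * (deriv (lagrange_poly xi j)).[xi m].

Definition H_elt : 'M[R]_P.+1 := (dx / 2) *: diag_mx (\row_j omega j).

Definition D_elt : 'M[R]_P.+1 := invmx H_elt *m Q_elt.

End Element.

Section TwoElements.
Context {R : realType} {P : nat}.
Variables (xi omega : 'I_P.+1 -> R) (dx : R).

Definition e_l : 'cV[R]_P.+1 := delta_mx ord0 0.
Definition e_r : 'cV[R]_P.+1 := delta_mx ord_max 0.

Definition H_two : 'M[R]_(P.+1 + P.+1) :=
  block_mx (H_elt omega dx) 0 0 (H_elt omega dx).

Definition D_two : 'M[R]_(P.+1 + P.+1) :=
  block_mx (D_elt xi omega dx) 0 0 (D_elt xi omega dx).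

Definition B_hat : 'M[R]_(P.+1 + P.+1) :=
  block_mx (e_r *m e_r^T) (- (e_r *m e_l^T))
           (e_l *m e_r^T) (- (e_l *m e_l^T)).

Definition B_tilde : 'M[R]_(P.+1 + P.+1) :=
  block_mx (- (e_l *m e_l^T)) 0 0 (e_r *m e_r^T).

Definition D_tilde : 'M[R]_(P.+1 + P.+1) :=
  D_two - 2^-1 *: (invmx H_two *m B_hat).

Definition ip_H (U V : 'cV[R]_(P.+1 + P.+1)) : R := (V^T *m H_two *m U) 0 0.

Definition ones : 'cV[R]_(P.+1 + P.+1) := const_mx 1.

(* Affine images of the nodes in [x_I - dx, x_I] and [x_I, x_I + dx]. *)
Definition grid (x_I : R) : 'rV[R]_(P.+1 + P.+1) :=
  row_mx (\row_j (x_I - dx + dx / 2 * (xi j + 1)))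
         (\row_j (x_I + dx / 2 * (xi j + 1))).

Definition nodal (x_I : R) (f : R -> R) : 'M[R]_(P.+1 + P.+1) :=
  diag_mx (map_mx f (grid x_I)).

(* The argument b is the diagonal matrix of nodal values. *)
Definition A_mat (b : 'M[R]_(P.+1 + P.+1)) : 'M[R]_(P.+1 + P.+1) :=
  D_two^T *m b *m H_two *m D_two
  - 2^-1 *: (B_hat^T *m b *m D_two + D_two^T *m b *m B_hat)
  + 4^-1 *: (B_hat^T *m b *m invmx H_two *m B_hat).

End TwoElements.

Arguments e_l : clear implicits.
Arguments e_r : clear implicits.
Arguments B_hat : clear implicits.
Arguments B_tilde : clear implicits.
Arguments ones : clear implicits.

(* Smoothness on a closed set: f is there the restriction of a function that is
   smooth on the whole line. *)
Definition smooth_on {R : realType} (A : set R) (f : R -> R) : Prop :=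
  exists2 g : R -> R, (forall (n : nat) (x : R), derivable (derive1n n g) x 1)
                    & forall x, A x -> f x = g x.

(* Main.v *)
(* Exactness of the quadrature on the derivatives of the Lagrange polynomials and
   sum_i phi_i = 1 give the summation-by-parts consequences Q 1 = 0 and
   1^T Q = e_r^T - e_l^T.  Hence the interface terms in 1^T H Dt cancel, leaving
   only 1^T B_tilde.  The stiffness term drops out because every summand of A_b
   has D^T or B_hat^T on the left, and D 1 = B_hat 1 = 0. *)
Require Import Defs.
From HB Require Import structures.
From mathcomp Require Import all_boot all_order all_algebra.
From mathcomp Require Import all_classical all_reals all_analysis.
Import Order.TTheory GRing.Theory Num.Theory.
Import numFieldNormedType.Exports.
Local Open Scope classical_set_scope.
Local Open Scope ring_scope.

Section Quadrature.
Context {R : realType} {P : nat}.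
Implicit Types xi omega : 'I_P.+1 -> R.

Lemma gll_nodes_inj xi : gll_nodes xi -> injective xi.
Proof.
case=> _ _ xi_mono _ i j xi_ij; apply/val_inj/eqP; rewrite eqn_leq.
apply/andP; split; rewrite leqNgt; apply/negP => /xi_mono;
  by rewrite xi_ij ltxx.
Qed.

(** The difference of the two sides has size at most [P.+1] but vanishes at the [P.+1] distinct
    nodes, so it cannot be nonzero. *)
Lemma sum_lagrange_poly xi : injective xi ->
  \sum_(i < P.+1) lagrange_poly xi i = 1.
Proof.
move=> xi_inj; apply/eqP; rewrite -subr_eq0; apply/negPn/negP => p_neq0.
have uniq_xi : uniq [seq xi k | k <- enum 'I_P.+1].
  by rewrite map_inj_uniq ?enum_uniq.
have root_xi : all (root (\sum_(i < P.+1) lagrange_poly xi i - 1))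
                   [seq xi k | k <- enum 'I_P.+1].
  apply/allP => _ /mapP[k _ ->]; rewrite rootE hornerD hornerN hornerC.
  rewrite horner_sum (bigD1 k) //= lagrange_poly_node // eqxx big1.
    by rewrite addr0 subrr.
  by move=> i ik; rewrite lagrange_poly_node // (negbTE ik).
have := max_poly_roots p_neq0 root_xi uniq_xi.
rewrite size_map size_enum_ord ltnNge => /negP; apply.
rewrite (leq_trans (size_polyD _ _)) // geq_max size_polyN size_poly1 andbT.
apply: (leq_trans (size_sum _ _ _)); apply/bigmax_leqP => i _.
by rewrite size_lagrange_poly.
Qed.

Lemma Rintegral_deriv_poly (p : {poly R}) (a b : R) : a < b ->
  \int[lebesgue_measure]_(x in `[a, b]) (deriv p).[x] = p.[b] - p.[a].
Proof.
move=> ab; rewrite /Rintegral (@continuous_FTC2 _ _ (horner p)) //.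
- exact/continuous_subspaceT/continuous_horner.
- split.
  + by move=> x _; exact: (ex_derive (is_derive := is_derive_poly p x)).
  + by apply: cvg_at_right_filter; exact: continuous_horner.
  + by apply: cvg_at_left_filter; exact: continuous_horner.
- by move=> x _; rewrite derive1E; exact: (derive_val (is_derive := is_derive_poly p x)).
Qed.

(** Row sums only involve the derivative of the sum of the Lagrange polynomials, which is the
    constant 1. *)
Lemma Q_elt_const xi omega : injective xi ->
  Q_elt xi omega *m const_mx 1 = 0 :> 'cV[R]_P.+1.
Proof.
move=> xi_inj; apply/matrixP => i j; rewrite !mxE.
under eq_bigr do rewrite !mxE mulr1.
rewrite exchange_big big1 //= => m _.
rewrite -mulr_sumr -horner_sum -raddf_sum sum_lagrange_poly //=.
by rewrite derivC horner0 mulr0.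
Qed.

(** Column sums replace the undifferentiated factor by 1. What remains is the quadrature of the
    derivative of [lagrange_poly xi j]; exactness turns it into the difference of the values at 1
    and -1, both of which are nodes. *)
Lemma const_Q_elt xi omega : (1 <= P)%N -> gll_rule xi omega ->
  const_mx 1 *m Q_elt xi omega = (e_r R P)^T - (e_l R P)^T.
Proof.
move=> P1 [nodes _ exact_rule]; have xi_inj := gll_nodes_inj _ nodes.
have [xi0 xi1 _ _] := nodes.
apply/matrixP => i j; rewrite !mxE ord1 eqxx andbT.
under eq_bigr do rewrite !mxE mul1r.
rewrite exchange_big /=.
transitivity (\sum_(m < P.+1) omega m * (deriv (lagrange_poly xi j)).[xi m]).
  apply: eq_bigr => m _; rewrite -mulr_suml -mulr_sumr -horner_sum.
  by rewrite sum_lagrange_poly // hornerC mulr1.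
(* The integrand has size at most [P], within the exactness bound [2 * P]. *)
rewrite -exact_rule; last first.
  apply: (leq_trans (size_poly _ _)); rewrite size_lagrange_poly //=.
  by rewrite leq_pmull.
rewrite Rintegral_deriv_poly; last exact: lt_trans (ltrN10 R) ltr01.
(* Only the evaluation point 1 becomes a node; the 1 hidden in [%:R] must stay. *)
by rewrite -xi0 -{1}xi1 !lagrange_poly_node // andbT.
Qed.

End Quadrature.

Section TwoElements.
Context {R : realType} {P : nat}.
Variables (xi omega : 'I_P.+1 -> R) (dx : R).
Hypothesis P_gt0 : (1 <= P)%N.
Hypothesis rule : gll_rule xi omega.
Hypothesis dx_gt0 : 0 < dx.

Lemma H_elt_unit : H_elt omega dx \in unitmx.
Proof.
have [_ omega_gt0 _] := rule.
rewrite unitmxE /H_elt detZ det_diag unitfE mulf_neq0 //.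
  by rewrite expf_neq0 // gt_eqF // divr_gt0.
by apply/prodf_neq0 => j _; rewrite mxE gt_eqF.
Qed.

Lemma H_two_unit : H_two omega dx \in unitmx.
Proof. by rewrite unitmxE det_ublock unitrM -!unitmxE H_elt_unit. Qed.

Lemma ones_col_mx : ones R P = col_mx (const_mx 1) (const_mx 1).
Proof. by rewrite col_mx_const. Qed.

Lemma tr_ones_row_mx : (ones R P)^T = row_mx (const_mx 1) (const_mx 1).
Proof. by rewrite trmx_const row_mx_const. Qed.

Lemma const_delta_mx n (i : 'I_n) :
  const_mx 1 *m (delta_mx i 0 : 'cV[R]_n) = 1%:M :> 'M[R]_1.
Proof.
apply/matrixP => k l; rewrite !mxE (bigD1 i) //= big1 => [|j ji].
  by rewrite !mxE !ord1 !eqxx mulr1 addr0.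
by rewrite !mxE (negbTE ji) mulr0.
Qed.

Lemma delta_mx_const n (i : 'I_n) :
  (delta_mx i 0 : 'cV[R]_n)^T *m const_mx 1 = 1%:M :> 'M[R]_1.
Proof. by rewrite -trmx_const -trmx_mul const_delta_mx trmx1. Qed.

Lemma D_two_ones : D_two xi omega dx *m ones R P = 0.
Proof.
have [nodes _ _] := rule.
rewrite ones_col_mx mul_block_col !mul0mx addr0 add0r /D_elt -mulmxA.
by rewrite (Q_elt_const _ _ (gll_nodes_inj _ nodes)) mulmx0 col_mx0.
Qed.

(** Each block row is a column times the jump functional across [x_I], and a constant has no
    jump. *)
Lemma B_hat_ones : B_hat R P *m ones R P = 0.
Proof.
rewrite ones_col_mx mul_block_col !mulNmx -!mulmxA !delta_mx_const !mulmx1.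
by rewrite !subrr col_mx0.
Qed.

Lemma ones_A_mat (b : 'M[R]_(P.+1 + P.+1)) :
  (ones R P)^T *m A_mat xi omega dx b = 0.
Proof.
have D0 : (ones R P)^T *m (D_two xi omega dx)^T = 0.
  by rewrite -trmx_mul D_two_ones trmx0.
have B0 : (ones R P)^T *m (B_hat R P)^T = 0.
  by rewrite -trmx_mul B_hat_ones trmx0.
rewrite /A_mat mulmxDr mulmxBr -!scalemxAr mulmxDr !mulmxA D0 B0 !mul0mx.
by rewrite !(addr0, scaler0, subr0).
Qed.

(** With [1] the all-ones row, [1 *m H *m D] is [(e_r^T - e_l^T, e_r^T - e_l^T)]. Both block rows of
    [B_hat] contribute equally, so half of [1 *m B_hat] is [(e_r^T, - e_l^T)]. Subtracting leaves
    [(- e_l^T, e_r^T)]. *)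
Lemma ones_H_D_tilde :
  (ones R P)^T *m H_two omega dx *m D_tilde xi omega dx
  = (ones R P)^T *m B_tilde R P.
Proof.
have HD : H_two omega dx *m D_two xi omega dx
          = block_mx (Q_elt xi omega) 0 0 (Q_elt xi omega).
  rewrite mulmx_block !mul0mx !mulmx0 !addr0 !add0r.
  by rewrite /D_elt mulKVmx ?H_elt_unit.
rewrite /D_tilde -mulmxA mulmxBr -scalemxAr mulKVmx ?H_two_unit // HD.
rewrite mulmxBr -scalemxAr tr_ones_row_mx !mul_row_block !mulmx0 !mulmxN.
rewrite !(mulmxA (const_mx 1)) !const_delta_mx !mul1mx const_Q_elt //.
rewrite addr0 !add0r -mulr2n -opprD -mulr2n scale_row_mx opp_row_mx add_row_mx.
have halve (v : 'rV[R]_P.+1) : 2^-1 *: (v *+ 2) = v.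
  by rewrite -[v *+ 2]scaler_nat scalerA mulVf ?pnatr_eq0 // scale1r.
rewrite scalerN !halve opprK addrNK addr0; congr row_mx.
by rewrite addrAC subrr add0r.
Qed.

End TwoElements.

(** Since [ip_H] transposes its second argument, symmetry is what brings [ones^T *m H] to the left
    of the right-hand side of the scheme. *)
Lemma ip_HC {R : realType} {P : nat} (omega : 'I_P.+1 -> R) (dx : R)
    (U V : 'cV[R]_(P.+1 + P.+1)) : ip_H omega dx U V = ip_H omega dx V U.
Proof.
have H_sym : (H_two omega dx)^T = H_two omega dx.
  by rewrite tr_block_mx !trmx0 linearZ /= tr_diag_mx.
have -> : ip_H omega dx U V = (V^T *m H_two omega dx *m U)^T 0 0.
  by rewrite [RHS]mxE.
by rewrite !trmx_mul trmxK H_sym mulmxA.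
Qed.

(** The product is a linear combination of the entries of [F s] with the constant coefficients
    [H_two omega dx *m Z], so it is differentiated entry by entry. *)
Lemma is_derive_ip_H {R : realType} {P : nat} (omega : 'I_P.+1 -> R) (dx : R)
    (Z V : 'cV[R]_(P.+1 + P.+1)) (F : R -> 'cV[R]_(P.+1 + P.+1)) (t : R) :
  is_derive t 1 F V ->
  is_derive t 1 (fun s => ip_H omega dx Z (F s)) (ip_H omega dx Z V).
Proof.
move=> dF.
have [/derivable_mxP dFc dFE] := dF.
have ipE X : ip_H omega dx Z X
    = \sum_j (H_two omega dx *m Z) j 0 * X j 0.
  rewrite /ip_H -mulmxA mxE.
  by apply: eq_bigr => j _; rewrite [X^T _ _]mxE mulrC.
have -> : (fun s => ip_H omega dx Z (F s))
  = \sum_(j < P.+1 + P.+1) (H_two omega dx *m Z) j 0 *: (fun s => F s j 0).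
  by apply/funext => s; rewrite ipE fct_sumE.
rewrite ipE; apply: is_derive_sum => j; apply: is_deriveZ.
apply: DeriveDef => //.
by rewrite -dFE derive_mx ?mxE //; exact: (ex_derive (is_derive := dF)).
Qed.

Theorem theorem10 (R : realType) (P : nat) (xi omega : 'I_P.+1 -> R)
    (x_I dx : R) (a b : R -> R) (J : interval R)
    (U W : R -> 'cV[R]_(P.+1 + P.+1))
    (am := nodal xi dx x_I a) (bm := nodal xi dx x_I b)
    (H := H_two omega dx) (Dt := D_tilde xi omega dx) :
  (1 <= P)%N ->
  gll_rule xi omega ->
  0 < dx ->
  smooth_on `[x_I - dx, x_I + dx] a ->
  smooth_on `[x_I - dx, x_I + dx] b ->
  (forall x, x \in `[x_I - dx, x_I + dx] -> 0 < b x) ->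
  open [set` J] ->
  (forall t, t \in J ->
     is_derive t 1 U (am *m Dt *m U t + W t)) ->
  (forall t, t \in J ->
     is_derive t 1 W (Dt *m (am *m W t)
                      - invmx H *m A_mat xi omega dx bm *m U t)) ->
  (forall t, t \in J -> (ones R P)^T *m B_tilde R P *m (am *m W t) = 0) ->
  forall t, t \in J ->
    is_derive t 1 (fun s => ip_H omega dx (ones R P) (W s)) 0 /\
    is_derive t 1 (fun s => ip_H omega dx (ones R P)
                              (derive1 U s - am *m Dt *m U s)) 0.
Proof.
move=> P1 rule dx0 _ _ _ openJ dU dW bdry t tJ.
have dipW : is_derive t 1 (fun s => ip_H omega dx (ones R P) (W s)) 0.
  apply: is_derive_eq.
    exact: (is_derive_ip_H _ _ _ _ _ _ (dW t tJ)).
  have H_unit : H \in unitmx by exact: H_two_unit rule dx0.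
  rewrite ip_HC /ip_H mulmxBr !mulmxA (ones_H_D_tilde _ _ _ P1 rule dx0) -/H.
  (* [H] cancels its inverse in the stiffness term, so [ones^T] meets [A_mat] directly. *)
  rewrite mulmxK // (ones_A_mat _ _ _ rule) mul0mx subr0.
  by rewrite -mulmxA bdry // mxE.
(* The first equation identifies [derive1 U s - am *m Dt *m U s] with [W s] only for [s] in [J]; as
   [J] is open, this holds near [t], which is enough for the derivative at [t]. *)
split=> //; apply: near_eq_is_derive dipW.
near=> s.
have sJ : s \in J by near: s; exact: open_nbhs_nbhs.
by rewrite derive1E (derive_val (is_derive := dU s sJ)) addrAC subrr add0r.
Unshelve. all: by end_near. Qed.
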